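(* Consider $n$ areas in the full propagation setting. Let the initial acceptance probabilities $p_1,\dots,p_n\in[0,1]$ be arbitrary numbers, and let the thresholds $c_1,\dots,c_n$ be drawn independently from one and the same (arbitrary, unknown) probability distribution on the positive integers. Then ordering all areas in non-increasing order of their initial acceptance probabilities is a best non-adaptive spreading strategy: if $\pi$ is a permutation of the areas with $p_{\pi(1)}\ge p_{\pi(2)}\ge\dots\ge p_{\pi(n)}$, then for every permutation $\pi'$ of the areas, the expected number of adopters under $\pi$ is at least the expected number of adopters under $\pi'$ (expectations being taken over both the random thresholds and the random decisions).
   Context: Full propagation setting. There are $n$ areas; area $v$ has a threshold $c_v\in\mathbb{Z}_{>0}$ and an initial acceptance probability $p_v\in[0,1]$. A non-adaptive spreading strategy is a permutation $\pi$ of the areas fixed in advance (without knowledge of the realized thresholds or decisions); $\pi(t)$ is the area scheduled at time $t$. When $v=\pi(t)$ is scheduled it makes an irrevocable decision $X_v\in\{1,-1\}$ ($1$ = accept, $-1$ = reject): with $I_{t-1}=\sum_{s<t}X_{\pi(s)}$, if $I_{t-1}\ge c_v$ then $X_v=1$; if $I_{t-1}\le -c_v$ then $X_v=-1$; if $|I_{t-1}|<c_v$ then $X_v=1$ with probability $p_v$ and $X_v=-1$ with probability $1-p_v$, using randomness independent of the past and of all thresholds. The number of adopters is the number of areas $v$ with $X_v=1$. *)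

(* Defs.v *)
From HB Require Import structures.
From mathcomp Require Import all_boot all_order all_algebra all_fingroup.
From mathcomp Require Import all_classical all_reals all_analysis.

Set Implicit Arguments.
Unset Strict Implicit.
Unset Printing Implicit Defensive.

Import Order.TTheory GRing.Theory Num.Theory.

Local Open Scope classical_set_scope.
Local Open Scope ring_scope.

Section Independence.
Context {R : realType} {d : measure_display} {T : measurableType d}.
Variable P : probability T R.

Definition mutually_independent (I : finType) (d' : measure_display)
    (T' : measurableType d') (Y : I -> {RV P >-> T'}) : Prop :=
  forall (J : {set I}) (A : I -> set T'), (forall i, measurable (A i)) ->
    P (\bigcap_(i in [set` J]) (Y i @^-1` A i)) =
    (\prod_(i in J) P (Y i @^-1` A i))%E.

(* The target types are countable and meant to carry their discrete
   sigma-algebra, hence no measurability condition on A and C. *)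
Definition discrete_independent (S1 S2 : countType)
    (Y : T -> S1) (Z : T -> S2) : Prop :=
  forall (A : set S1) (C : set S2),
    P (Y @^-1` A `&` Z @^-1` C) = (P (Y @^-1` A) * P (Z @^-1` C))%E.

End Independence.

Section FullPropagation.
Variables (T : Type) (n : nat).

(* Times and areas are both indexed by 'I_n, so the first time is 0 and
   pi t is the area scheduled at time t. *)
Implicit Types (pi : {perm 'I_n}) (c : 'I_n -> T -> nat)
  (B : 'I_n -> T -> bool) (X : 'I_n -> T -> int) (t : 'I_n).

(* Sum of the decisions made strictly before time t: I_{t-1} when time
   starts at 1. *)
Definition opinion_before pi X t (w : T) : int :=
  \sum_(s < n | (s < t)%N) X (pi s) w.

Definition past_decisions pi X t (w : T) : seq int :=
  [seq X (pi s) w | s : 'I_n <- enum 'I_n & (s < t)%N].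

Definition thresholds_and_past pi c X t (w : T) : {ffun 'I_n -> nat} * seq int :=
  ([ffun v => c v w], past_decisions pi X t w).

(* B v is the coin area v uses when neither threshold condition applies. *)
Definition follows_decision_rule pi c B X : Prop :=
  forall t w, let v := pi t in let I := opinion_before pi X t w in
    X v w = if (c v w)%:Z <= I then 1
            else if I <= - (c v w)%:Z then -1
            else if B v w then 1 else -1.

Definition number_of_adopters X (w : T) : nat := #|[set v | X v w == 1]%SET|.

End FullPropagation.

(* Thresholds are i.i.d. with law mu, the coin of area v is heads with
   probability p v, and the coin tossed at time t is independent of all
   thresholds together with the decisions made before t. *)
Record full_propagation (R : realType) (d : measure_display)
    (T : measurableType d) (P : probability T R) (n : nat)
    (p : 'I_n -> R) (mu : probability nat R) (pi : {perm 'I_n})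
    (c : 'I_n -> {RV P >-> nat}) (B : 'I_n -> {RV P >-> bool})
    (X : 'I_n -> T -> int) : Prop := {
  thresholds_law : forall (v : 'I_n) (A : set nat), distribution P (c v) A = mu A ;
  thresholds_independent : mutually_independent c ;
  coin_law : forall v : 'I_n, P [set w | B v w = true] = (p v)%:E ;
  coin_independent : forall t : 'I_n,
    discrete_independent P (B (pi t)) (thresholds_and_past pi c X t) ;
  decisions : follows_decision_rule pi c B X
}.

Definition expected_adopters (R : realType) (d : measure_display)
    (T : measurableType d) (P : probability T R) (n : nat)
    (X : 'I_n -> T -> int) : \bar R :=
  'E_P[fun w => (number_of_adopters X w)%:R].

(* Main.v *)
(* In opinion [i] an area of initial acceptance probability [x] accepts with
   probability [1 - q i * (1 - x)] if [i >= 0] and [q (- i) * x] if [i <= 0],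
   where [q m] is the probability that a threshold exceeds [m], so the opinion
   is a Markov chain.  The number of adopters is an increasing function of the
   final opinion.  Exchange two consecutive areas so that the one of larger
   probability comes first: from any opinion this makes the two-step move [+2]
   at least as likely and the two-step move [-2] at most as likely as before,
   because [q] is non-increasing.  The remaining expected value is monotone
   along opinions of the same parity, so such an exchange never hurts, and
   insertion sort concludes. *)
Require Import Defs.
From HB Require Import structures.
From mathcomp Require Import all_boot all_order all_algebra all_fingroup.
From mathcomp Require Import all_classical all_reals all_analysis.
From mathcomp Require Import measurable_realfun ring lra zify.

Set Implicit Arguments.
Unset Strict Implicit.
Unset Printing Implicit Defensive.

Import Order.TTheory GRing.Theory Num.Theory.

Local Open Scope classical_set_scope.
Local Open Scope ring_scope.

(** * The opinion chain and the exchange argument *)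

Section AcceptanceChain.
Variables (R : realFieldType) (q : nat -> R).
Implicit Types (h : int -> R) (l : seq R) (i : int) (x y : R) (m t k : nat).

(* [q m] is the probability that the threshold exceeds [m]. *)
Definition accept_prob i x : R :=
  (if 0 <= i then 1 - q `|i|%N else 0) + q `|i|%N * x.

(* Expected value of [h] at the final opinion, starting from opinion [i] with
   areas of acceptance probabilities [l] still to be scheduled. *)
Fixpoint final_mean h l i : R :=
  if l is x :: l' then
    accept_prob i x * final_mean h l' (i + 1)
    + (1 - accept_prob i x) * final_mean h l' (i - 1)
  else h i.

(* Law of the number of adopters among the first [t] areas; with [k] adopters
   the opinion is [2 k - t]. *)
Fixpoint adopters_law l t k : R :=
  if t is t'.+1 then
    adopters_law l t' k * (1 - accept_prob (k.*2%:Z - t'%:Z) (nth 0 l t'))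
    + (if k is k'.+1 then
         adopters_law l t' k' * accept_prob (k'.*2%:Z - t'%:Z) (nth 0 l t')
       else 0)
  else (k == 0)%:R.

Lemma adopters_law_gt l t k : (t < k)%N -> adopters_law l t k = 0.
Proof.
elim: t k => [|t IH] [|k] //= tk.
by rewrite !IH ?mul0r ?addr0 // ltnW.
Qed.

(** The sum does not depend on [t]: splitting the mass at each count over the two decisions is one
    unfolding of [final_mean]. This links the forward law to the backward recursion. *)
Lemma final_mean_law h l t : (t <= size l)%N ->
  \sum_(k < t.+1) adopters_law l t k * final_mean h (drop t l) (k.*2%:Z - t%:Z)
  = final_mean h l 0.
Proof.
elim: t => [|t IH] tl; first by rewrite big_ord1 /= mul1r drop0 subr0.
rewrite -IH ?(ltnW tl)// (drop_nth 0 tl) /=.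
under eq_bigr do rewrite mulrDl.
(* The rejection sum has no mass at [t.+1] and the acceptance sum none at 0, so after a shift both
   run over [k <= t]. *)
rewrite big_split /= big_ord_recr /= adopters_law_gt // !mul0r addr0.
rewrite [X in _ + X = _]big_ord_recl /= mul0r add0r -big_split /=.
apply: eq_bigr => k _.
rewrite /bump add1n /=.
have -> : k.*2%:Z - t.+1%:Z = k.*2%:Z - t%:Z - 1 by lia.
have -> : (k : nat).+1.*2%:Z - t.+1%:Z = k.*2%:Z - t%:Z + 1 by lia.
by ring.
Qed.

Hypotheses (q0 : q 0 = 1) (q_ge0 : forall m, 0 <= q m)
  (q_anti : forall m, q m.+1 <= q m).

Let q_le1 m : q m <= 1.
Proof. by elim: m => [|m IH]; rewrite ?q0 // (le_trans (q_anti m)). Qed.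

Lemma accept_prob_pos m x : accept_prob m%:Z x = 1 - q m * (1 - x).
Proof. by rewrite /accept_prob /=; ring. Qed.

(** At [m = 0] the extra summand [1 - q 0] vanishes, so both closed forms are valid at opinion 0. *)
Lemma accept_prob_neg m x : accept_prob (- m%:Z) x = q m * x.
Proof.
rewrite /accept_prob abszN absz_nat oppr_ge0 lez_nat leqn0.
by case: eqP => [->|_]; rewrite ?q0 ?subrr add0r.
Qed.

Lemma accept_prob_itv i x : 0 <= x <= 1 -> 0 <= accept_prob i x <= 1.
Proof.
move=> /andP[x0 x1].
have [m [->|->]] : exists m : nat, i = m%:Z \/ i = - m%:Z.
  by exists `|i|%N; lia.
- by rewrite accept_prob_pos; have := q_ge0 m; have := q_le1 m; nra.
- by rewrite accept_prob_neg; have := q_ge0 m; have := q_le1 m; nra.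
Qed.

Variable h : int -> R.
Hypothesis h_mono : forall i, h i <= h (i + 2).

(** One step from [i] leads to at most [i + 1], one step from [i + 2] to at least [i + 1]; the value
    at [i + 1] separates the two means. *)
Lemma final_mean_mono l i : all (fun x => 0 <= x <= 1) l ->
  final_mean h l i <= final_mean h l (i + 2).
Proof.
elim: l i => [|x l IH] i //= /andP[x01 l01].
have /andP[u0 u1] := accept_prob_itv i x01.
have /andP[v0 v1] := accept_prob_itv (i + 2) x01.
have := IH (i - 1) l01; have := IH (i + 1) l01.
rewrite (_ : i + 1 + 2 = i + 2 + 1); last by lia.
rewrite (_ : i - 1 + 2 = i + 1); last by lia.
rewrite (_ : i + 2 - 1 = i + 1); last by lia.
move=> A B; apply: (@le_trans _ _ (final_mean h l (i + 1))); nra.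
Qed.

(** For [i > 0] the probability of two rejections is symmetric in [x] and [y], for [i < 0] that of
    two acceptances. So the gain only shifts mass from [b] to [c], or from [a] to [b]. *)
Lemma final_mean_swap l i x y : all (fun x => 0 <= x <= 1) l -> y <= x ->
  final_mean h (y :: x :: l) i <= final_mean h (x :: y :: l) i.
Proof.
move=> l01 yx /=.
rewrite (_ : i + 1 + 1 = i + 2); last by lia.
rewrite (_ : i + 1 - 1 = i); last by lia.
rewrite (_ : i - 1 + 1 = i); last by lia.
rewrite (_ : i - 1 - 1 = i - 2); last by lia.
have := final_mean_mono (i - 2) l01; have := final_mean_mono i l01.
rewrite (_ : i - 2 + 2 = i); last by lia.
move: (final_mean h l (i - 2)) (final_mean h l i) (final_mean h l (i + 2)).
move=> a b c bc ab; rewrite -subr_ge0.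
have [m [im|im]] : exists m : nat, i = m.+1%:Z \/ i = - m%:Z.
  case: (lerP i 0) => i0; first by exists `|i|%N; lia.
  by exists `|i|%N.-1; lia.
- rewrite (_ : i + 1 = m.+2%:Z); last by lia.
  rewrite (_ : i - 1 = m%:Z); last by lia.
  rewrite im !accept_prob_pos.
  rewrite [leRHS](_ : _ = (x - y) * (q m.+1 - q m.+2) * (c - b)); last by ring.
  by rewrite !mulr_ge0 ?subr_ge0.
(* At opinion 0 neither extreme is symmetric: equal mass leaves [a] and reaches [c]. *)
case: m im => [|m] im.
  rewrite im oppr0 add0r sub0r !accept_prob_neg !(accept_prob_pos 0).
  rewrite !(accept_prob_pos 1) q0.
rewrite [leRHS](_ : _ = (x - y) * (1 - q 1) * (c - a)); last by ring.
  by rewrite !mulr_ge0 ?subr_ge0 ?(le_trans ab bc).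
rewrite (_ : i + 1 = - m%:Z); last by lia.
rewrite (_ : i - 1 = - m.+2%:Z); last by lia.
rewrite im !accept_prob_neg.
rewrite [leRHS](_ : _ = (x - y) * (q m.+1 - q m.+2) * (b - a)); last by ring.
by rewrite !mulr_ge0 ?subr_ge0.
Qed.

Lemma le_final_mean_cons x l l' i : 0 <= x <= 1 ->
  (forall j, final_mean h l j <= final_mean h l' j) ->
  final_mean h (x :: l) i <= final_mean h (x :: l') i.
Proof.
move=> x01 ll' /=; have /andP[u0 u1] := accept_prob_itv i x01.
by apply: lerD; apply: ler_wpM2l; rewrite ?subr_ge0.
Qed.

(** Merging with a singleton is insertion: [x] passes the larger entries one at a time, each time by
    [final_mean_swap]. *)
Lemma final_mean_insert x l i : all (fun x => 0 <= x <= 1) (x :: l) ->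
  final_mean h (x :: l) i <= final_mean h (merge >=%R [:: x] l) i.
Proof.
elim: l i => [|y l IH] i //= /and3P[x01 y01 l01].
case: ifP => [//|yx].
apply: (le_trans (final_mean_swap _ l01 _)).
  by rewrite ltW // ltNge yx.
by apply: le_final_mean_cons => // j; apply: IH; rewrite /= x01.
Qed.

Lemma final_mean_le_sorted l l' i : all (fun x => 0 <= x <= 1) l ->
  perm_eq l l' -> sorted >=%R l' -> final_mean h l i <= final_mean h l' i.
Proof.
elim: l l' i => [|x l IH] l' i.
  by rewrite perm_sym => _ /perm_nilP ->.
move=> /andP[x01 l01] ll' l's.
have tot : total (>=%R : rel R) by move=> a b; apply: le_total.
have sl : perm_eq l (sort >=%R l) by rewrite perm_sym perm_sort.
(* A sorted rearrangement is unique, so [l'] arises by inserting [x] into the sorted tail. *)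
have -> : l' = merge >=%R [:: x] (sort >=%R l).
  apply: (@sorted_eq _ >=%R) => //; first exact: ge_trans.
  - by move=> a b /andP[ab ba]; apply/le_anti/andP.
  - by apply: merge_sorted => //; apply: sort_sorted.
  - rewrite perm_sym perm_merge /= perm_sym -(permPl ll').
    by rewrite perm_cons.
apply: le_trans (final_mean_insert _ _); last first.
  by rewrite /= x01 (perm_all _ (permEl (perm_sort _ _))).
apply: le_final_mean_cons => // j.
by apply: IH => //; apply: sort_sorted.
Qed.

End AcceptanceChain.

(** * The law of the adopter count in an actual run *)

Section FullPropagationRun.
Variables (R : realType) (n : nat) (p : 'I_n -> R) (mu : probability nat R).
Hypothesis mu_pos : mu [set k : nat | (0 < k)%N] = 1%E.
Variables (pi : {perm 'I_n}) (d : measure_display) (T : measurableType d)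
  (P : probability T R) (c : 'I_n -> {RV P >-> nat})
  (B : 'I_n -> {RV P >-> bool}) (X : 'I_n -> T -> int).
Hypothesis run : full_propagation p mu pi c B X.
Implicit Types (t k : nat) (v : 'I_n) (S : set T) (A : 'I_n -> set nat).

Definition threshold_tail m : R := fine (mu [set k : nat | (m < k)%N]).

Definition scheduled_probs : seq R := [seq p (pi s) | s <- enum 'I_n].

Definition adopters_before t (w : T) : nat :=
  \sum_(s < n | (s < t)%N) (X (pi s) w == 1).

(** The sets [A] are indexed by time, not by area. *)
Definition remaining_thresholds_in t A : set T :=
  [set w | forall s : 'I_n, (t <= s)%N -> A s (c (pi s) w)].

Lemma adopters_beforeS (s : 'I_n) w :
  adopters_before s.+1 w = (adopters_before s w + (X (pi s) w == 1%R))%N.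
Proof.
rewrite /adopters_before (bigD1 s) //= addnC; congr (_ + _)%N.
by apply: eq_bigl => j; rewrite ltnS ltn_neqAle andbC.
Qed.

Lemma adopters_before_past (t : 'I_n) w :
  adopters_before t w = count_mem 1 (past_decisions pi X t w).
Proof.
rewrite /past_decisions -sum1_count big_map big_filter_cond big_enum_cond /=.
rewrite /adopters_before [RHS]big_mkcondr.
by apply: eq_bigr => s _; case: eqP.
Qed.

Lemma decision_pm1 v w : X v w = if X v w == 1 then 1 else -1.
Proof.
rewrite -(permKV pi v) (decisions run).
by case: ifP => // _; case: ifP => // _; case: ifP.
Qed.

Lemma opinion_beforeE (t : 'I_n) w :
  opinion_before pi X t w = (adopters_before t w).*2%:Z - t%:Z.
Proof.
have -> : t%:Z = \sum_(s < n | (s < t)%N) (1 : int).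
  by rewrite (big_ord_narrow (ltnW (ltn_ord t))) sumr_const card_ord natz.
rewrite /adopters_before -mul2n PoszM raddf_sum mulr_sumr -sumrB.
by apply: eq_bigr => s _; rewrite decision_pm1; case: ifP.
Qed.

Lemma adoptE (s : 'I_n) w (j := opinion_before pi X s w) :
  (X (pi s) w == 1) =
  (((c (pi s) w)%:Z <= j) || ((`|j| < c (pi s) w)%N && B (pi s) w)).
Proof.
rewrite (decisions run s w) -/j.
case: ifP => //= cj; case: ifP => cj'; first by rewrite (_ : (_ < _)%N = false) //; lia.
by rewrite (_ : (_ < _)%N = true); [case: (B _ _)|lia].
Qed.

Lemma measurable_threshold v (C : set nat) : measurable (c v @^-1` C).
Proof. exact: measurable_funPTI. Qed.

Lemma measurable_coin v : measurable [set w | B v w].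
Proof. exact: (@measurable_funPTI _ _ _ _ (B v) [set true]). Qed.

Lemma measurable_remaining t A : measurable (remaining_thresholds_in t A).
Proof.
rewrite (_ : remaining_thresholds_in t A =
    \bigcap_(s in [set s : 'I_n | (t <= s)%N]) (c (pi s) @^-1` A s)) //.
apply: fin_bigcap_measurable => // s _; exact: measurable_threshold.
Qed.

(* Given [k] adopters, the area scheduled at time [s] accepts at once if its
   threshold lies in the first set and tosses its coin if it lies in the
   second one. *)
Definition sure_thresholds (s : 'I_n) k : set nat :=
  [set m | m%:Z <= k.*2%:Z - s%:Z].
Definition coin_thresholds (s : 'I_n) k : set nat :=
  [set m | (`|k.*2%:Z - s%:Z|%N < m)%N].

Definition count_event t k : set T := adopters_before t @^-1` [set k].
Definition adopt_event (s : 'I_n) : set T := [set w | X (pi s) w == 1].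

Lemma count_adopt (s : 'I_n) k :
  count_event s k `&` adopt_event s =
  count_event s k `&` (c (pi s) @^-1` sure_thresholds s k)
  `|` count_event s k `&`
      (c (pi s) @^-1` coin_thresholds s k `&` [set w | B (pi s) w]).
Proof.
rewrite -setIUr; apply/seteqP; split=> w /=; rewrite /count_event /= => -[<-];
  rewrite /adopt_event /= adoptE opinion_beforeE.
- by move=> /orP[h|/andP[h1 h2]]; split => //; [left|right].
- by move=> [h|[h1 h2]]; split => //; apply/orP; [left|right; apply/andP].
Qed.

Lemma count_eventS (s : 'I_n) k :
  count_event s.+1 k = (count_event s k `\` adopt_event s) `|`
    (if k is k'.+1 then count_event s k' `&` adopt_event s else set0).
Proof.
apply/seteqP; split=> w; rewrite /count_event /adopt_event /= adopters_beforeS.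
- case E: (X _ w == 1); rewrite /= ?addn0 ?addn1 => <-; first by right; split.
  by left; split.
- move=> [[<- /negP/negPf ->]|]; first by rewrite addn0.
  by case: k => [//|k] [<- ->]; rewrite addn1.
Qed.

(** The decisions [X] are plain functions; measurability comes by induction on time from thresholds
    and coins, through [count_adopt]. *)
Lemma measurable_count t k : (t <= n)%N -> measurable (count_event t k).
Proof.
elim: t k => [|t IH] k tn.
  rewrite (_ : count_event 0 k = if k == 0%N then setT else set0).
    by case: ifP => _; [exact: measurableT|exact: measurable0].
  by apply/seteqP; split=> w; rewrite /count_event /adopters_before /= big_pred0_eq;
    case: k.
have mA k' : measurable (count_event t k' `&` adopt_event (Ordinal tn)).
  rewrite (count_adopt (Ordinal tn)); apply: measurableU.
    by apply: measurableI; [apply: IH (ltnW tn)|exact: measurable_threshold].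
  apply: measurableI; first by apply: IH (ltnW tn).
  by apply: measurableI; [exact: measurable_threshold|exact: measurable_coin].
rewrite (count_eventS (Ordinal tn)); apply: measurableU; last by case: k.
rewrite (_ : _ `\` _ = count_event t k `\`
    (count_event t k `&` adopt_event (Ordinal tn))); last first.
  by rewrite setDIr setDv set0U.
by apply: measurableD; [apply: IH (ltnW tn)|exact: mA].
Qed.



Lemma fine_probU S S' : measurable S -> measurable S' -> S `&` S' = set0 ->
  fine (P (S `|` S')) = fine (P S) + fine (P S').
Proof. by move=> mS mS' dSS'; rewrite measureU // fineD ?fin_num_measure. Qed.

Lemma fine_probD S S' : measurable S -> measurable S' ->
  fine (P (S `\` S')) = fine (P S) - fine (P (S `&` S')).
Proof.
move=> mS mS'; rewrite measureD // ?fineB ?fin_num_measure //.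
- exact: measurableI.
- by rewrite -ge0_fin_numE ?fin_num_measure.
Qed.

Lemma threshold_tail0 : threshold_tail 0 = 1.
Proof. by rewrite /threshold_tail mu_pos. Qed.

Lemma threshold_tail_ge0 m : 0 <= threshold_tail m.
Proof. exact: fine_ge0. Qed.

Lemma threshold_tail_anti m : threshold_tail m.+1 <= threshold_tail m.
Proof.
rewrite fine_le ?fin_num_measure // le_measure ?inE //= => k /=.
exact: ltnW.
Qed.

Lemma accept_probE (s : 'I_n) k x :
  accept_prob threshold_tail (k.*2%:Z - s%:Z) x =
  fine (mu (sure_thresholds s k)) + x * fine (mu (coin_thresholds s k)).
Proof.
rewrite /accept_prob [x * _]mulrC /sure_thresholds /coin_thresholds; congr (_ + _).
set j := _ - _; case: ifP => j0.
  rewrite (_ : [set _ | _] = ~` [set m | (`|j|%N < m)%N]).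
    by rewrite probability_setC // fineB ?fin_num_measure.
  by apply/seteqP; split=> m /=; lia.
rewrite (_ : [set _ | _] = set0) ?measure0 //.
by apply/seteqP; split=> m //=; lia.
Qed.

Lemma remaining_update (s : 'I_n) A (C : set nat) :
  c (pi s) @^-1` C `&` remaining_thresholds_in s.+1 A =
  remaining_thresholds_in s (fun j => if j == s then C else A j).
Proof.
apply/seteqP; split=> w /=.
  move=> [Cs rem] j; rewrite leq_eqVlt => /predU1P[/val_inj <-|sj].
    by rewrite eqxx.
  by case: eqP => [->//|_]; apply: rem.
move=> rem; split; first by have := rem s (leqnn _); rewrite eqxx.
move=> j sj; have := rem j (ltnW sj); case: eqP => // js.
by rewrite js ltnn in sj.
Qed.

Lemma prod_update (s : 'I_n) A (C : set nat) :
  \prod_(j < n | (s <= j)%N) fine (mu (if j == s then C else A j)) =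
  fine (mu C) * \prod_(j < n | (s < j)%N) fine (mu (A j)).
Proof.
rewrite (bigD1 s) //= eqxx; congr (_ * _).
apply: eq_big => [j|j /andP[_ /negPf ->]//].
by rewrite ltn_neqAle eq_sym andbC.
Qed.

Lemma coin_count (s : 'I_n) k A :
  fine (P (count_event s k `&` remaining_thresholds_in s A `&`
           [set w | B (pi s) w])) =
  p (pi s) * fine (P (count_event s k `&` remaining_thresholds_in s A)).
Proof.
(* The event is a function of all thresholds and the past decisions, which is what the coin is
   independent of. *)
pose E := [set z : {ffun 'I_n -> nat} * seq int |
  count_mem 1 z.2 = k /\ forall j : 'I_n, (s <= j)%N -> A j (z.1 (pi j))].
have EE : thresholds_and_past pi c X s @^-1` E =
    count_event s k `&` remaining_thresholds_in s A.
  apply/seteqP; split=> w; rewrite /E /count_event /= adopters_before_past.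
    by move=> [h1 h2]; split => // j sj; have := h2 j sj; rewrite ffunE.
  by move=> [h1 h2]; split => // j sj; rewrite ffunE; apply: h2.
have := coin_independent run s [set true] E.
rewrite EE setIC => ->.
have -> : P (B (pi s) @^-1` [set true]) = (p (pi s))%:E by rewrite -(coin_law run).
rewrite fineM //= fin_num_measure //.
by apply: measurableI; [apply: measurable_count; apply: ltnW|exact: measurable_remaining].
Qed.

Lemma thresholds_joint A :
  fine (P (remaining_thresholds_in 0 A)) = \prod_(s < n) fine (mu (A s)).
Proof.
(* Independence is stated by area, hence the passage through the inverse of [pi]. *)
have := @thresholds_independent _ _ _ _ _ _ _ _ _ _ _ run [set: 'I_n]%SET
  (fun v => A (pi^-1 v)%g) (fun=> I).
rewrite (_ : \bigcap_(i in _) _ = remaining_thresholds_in 0 A); last first.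
  apply/seteqP; split=> w /= h v.
    by move=> _; have := h (pi v); rewrite /= inE permK; apply.
  by move=> _; have := h (pi^-1 v)%g isT; rewrite permKV.
move=> ->; rewrite (eq_bigr (fun v => (fine (mu (A (pi^-1 v)%g)))%:E)); last first.
  move=> v _; rewrite fineK ?fin_num_measure //.
  by rewrite -(thresholds_law run v).
rewrite prodEFin /= (reindex_inj (@perm_inj _ pi)) /=.
by apply: eq_big => [v|v _]; rewrite ?inE // permK.
Qed.

(** The next decision uses a threshold that must be independent of the current count, so the
    induction carries arbitrary constraints on all thresholds still to come. *)
Lemma count_law t k A : (t <= n)%N ->
  fine (P (count_event t k `&` remaining_thresholds_in t A)) =
  adopters_law threshold_tail scheduled_probs t k *
  \prod_(s < n | (t <= s)%N) fine (mu (A s)).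
Proof.
elim: t k A => [|t IH] k A tn.
  rewrite /= -thresholds_joint.
  case: k => [|k].
    rewrite mul1r (_ : count_event 0 0 = setT) ?setTI //.
    by apply/seteqP; split=> // w _; rewrite /count_event /adopters_before /= big_pred0_eq.
  rewrite mul0r (_ : count_event 0 k.+1 = set0) ?set0I ?measure0 //.
  by apply/seteqP; split=> // w; rewrite /count_event /adopters_before /= big_pred0_eq.
pose s := Ordinal tn; have {}IH k' A' := IH k' A' (ltnW tn).
rewrite -[t]/(s : nat) in IH *.
set Q := \prod_(_ < n | _) _.
set L := scheduled_probs; set q := threshold_tail.
have mc k' : measurable (count_event s k') by apply: measurable_count; apply: ltnW.
have mr t' A' : measurable (remaining_thresholds_in t' A').
  exact: measurable_remaining.
have upd k' C : fine (P (count_event s k' `&` (c (pi s) @^-1` C) `&`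
    remaining_thresholds_in s.+1 A)) = adopters_law q L s k' * (fine (mu C) * Q).
  by rewrite -setIA remaining_update IH prod_update.
have mct k' : measurable (count_event s k' `&` adopt_event s).
  rewrite count_adopt; apply: measurableU; apply: measurableI => //.
    exact: measurable_threshold.
  by apply: measurableI; [exact: measurable_threshold|exact: measurable_coin].
have adopt k' : fine (P (count_event s k' `&` adopt_event s `&`
    remaining_thresholds_in s.+1 A)) =
    adopters_law q L s k' * accept_prob q (k'.*2%:Z - s%:Z) (nth 0 L s) * Q.
  have -> : nth 0 L s = p (pi s).
    by rewrite (nth_map s) ?size_enum_ord // nth_ord_enum.
  rewrite count_adopt setIUl fine_probU; last first.
  - apply/seteqP; split=> // w [[[_ sure] _] [[_ [coin _]] _]].
    by move: sure coin; rewrite /sure_thresholds /coin_thresholds /=; lia.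
  - apply: measurableI => //; apply: measurableI => //.
    by apply: measurableI; [exact: measurable_threshold|exact: measurable_coin].
  - do 2 apply: measurableI => //.
    exact: measurable_threshold.
  rewrite upd setIA setIAC -(setIA (count_event _ _)) remaining_update coin_count.
  rewrite -remaining_update setIA upd accept_probE; ring.
have stay k' : fine (P ((count_event s k' `\` adopt_event s) `&`
    remaining_thresholds_in s.+1 A)) =
    adopters_law q L s k' * (1 - accept_prob q (k'.*2%:Z - s%:Z) (nth 0 L s)) * Q.
  (* Rejection is the complement of acceptance; the total is [upd] with the trivial constraint. *)
  rewrite (_ : _ `&` _ = (count_event s k' `&` remaining_thresholds_in s.+1 A) `\`
      (count_event s k' `&` adopt_event s `&` remaining_thresholds_in s.+1 A)); last first.
    by apply/seteqP; split=> w /=; tauto.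
  rewrite fine_probD; [|exact: measurableI..].
  rewrite (_ : _ `&` (_ `&` _) =
      count_event s k' `&` adopt_event s `&` remaining_thresholds_in s.+1 A); last first.
    by apply/seteqP; split=> w /=; tauto.
  have := upd k' setT; rewrite preimage_setT setIT probability_setT => ->.
  by rewrite adopt /=; ring.
have mstay k' : measurable (count_event s k' `\` adopt_event s).
  rewrite (_ : _ `\` _ = count_event s k' `\` (count_event s k' `&` adopt_event s)).
    exact: measurableD.
  by rewrite setDIr setDv set0U.
rewrite count_eventS setIUl fine_probU; last first.
- apply/seteqP; split=> // w [[[_ no] _]]; case: k => [[]//|k] [[_ yes] _].
  by apply: no.
- by apply: measurableI => //; case: k.
- exact: measurableI.
rewrite stay; case: k => [|k] /=.
  by rewrite set0I measure0 !addr0.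
by rewrite adopt mulrDl.
Qed.

Lemma expected_adoptersE : expected_adopters P X =
  (\sum_(k < n.+1) k%:R * adopters_law threshold_tail scheduled_probs n k)%:E.
Proof.
have countE w : number_of_adopters X w = adopters_before n w.
  rewrite /number_of_adopters /adopters_before -sum1_card.
  rewrite (reindex_inj (@perm_inj _ pi)) big_mkcond [RHS]big_mkcond /=.
  by apply: eq_bigr => s _; rewrite inE ltn_ord; case: eqP.
have le_n w : (adopters_before n w < n.+1)%N.
  by rewrite -countE ltnS /number_of_adopters -[X in (_ <= X)%N]card_ord max_card.
have mC k : measurable (count_event n k) by apply: measurable_count.
rewrite /expected_adopters unlock.
under eq_integral => w _.
  rewrite (_ : _%:R = \sum_(k < n.+1) k%:R * \1_(count_event n k) w); last first.
    rewrite (bigD1 (Ordinal (le_n w))) //= indicE mem_set // mulr1 big1 ?addr0 ?countE //.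
    move=> k kw; rewrite indicE memNset ?mulr0 //= => wk.
    by case/eqP: kw; apply: val_inj.
  rewrite -sumEFin.
  under eq_bigr do rewrite EFinM.
  over.
rewrite /= ge0_integral_sum //=; last first.
  move=> k; apply: measurable_funeM; apply/measurable_EFinP.
  exact: measurable_indic.
rewrite -sumEFin; apply: eq_bigr => k _.
rewrite ge0_integralZl_EFin //; last first.
  by apply/measurable_EFinP; exact: measurable_indic.
rewrite integral_indic // setIT EFinM; congr (_ * _)%E.
have := count_law k (fun=> setT) (leqnn n).
rewrite (_ : remaining_thresholds_in _ _ = setT); last by apply/seteqP.
rewrite setIT big1 ?mulr1; last by move=> s _; rewrite probability_setT.
by move=> <-; rewrite fineK ?fin_num_measure.
Qed.

(** With [k] adopters the final opinion is [2 k - n], so this payoff returns [k]. *)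
Lemma expected_adopters_mean : expected_adopters P X =
  (final_mean threshold_tail (fun i => (i + n%:Z)%:~R / 2) scheduled_probs 0)%:E.
Proof.
have sz : size scheduled_probs = n by rewrite size_map size_enum_ord.
rewrite expected_adoptersE -(@final_mean_law _ _ _ _ n) ?sz //; congr _%:E.
apply: eq_bigr => k _; rewrite mulrC drop_oversize ?sz //=; congr (_ * _).
by rewrite subrK -pmulrn -mul2n natrM mulrC mulKf // pnatr_eq0.
Qed.

End FullPropagationRun.

Theorem theorem3 (R : realType) (n : nat) (p : 'I_n -> R)
    (hp : forall v : 'I_n, 0 <= p v <= 1)
    (mu : probability nat R) (mu_pos : mu [set k : nat | (0 < k)%N] = 1%E)
    (pi : {perm 'I_n})
    (p_sorted : forall s t : 'I_n, (s <= t)%N -> p (pi t) <= p (pi s))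
    (pi' : {perm 'I_n})
    (* a run of the strategy pi *)
    (d : measure_display) (T : measurableType d) (P : probability T R)
    (c : 'I_n -> {RV P >-> nat}) (B : 'I_n -> {RV P >-> bool})
    (X : 'I_n -> T -> int)
    (run : full_propagation p mu pi c B X)
    (* a run of the strategy pi', possibly on another probability space *)
    (d' : measure_display) (T' : measurableType d') (P' : probability T' R)
    (c' : 'I_n -> {RV P' >-> nat}) (B' : 'I_n -> {RV P' >-> bool})
    (X' : 'I_n -> T' -> int)
    (run' : full_propagation p mu pi' c' B' X') :
  (expected_adopters P' X' <= expected_adopters P X)%E.
Proof.
rewrite (expected_adopters_mean run) (expected_adopters_mean run').
rewrite lee_fin; apply: final_mean_le_sorted.
- exact: threshold_tail0.
- exact: threshold_tail_ge0.
- exact: threshold_tail_anti.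
- by move=> i; rewrite ler_pM2r ?invr_gt0 // ler_int; lia.
- by apply/allP => _ /mapP[s _ ->].
- rewrite /scheduled_probs (map_comp p pi') (map_comp p pi) perm_map //.
  have enum_perm (rho : {perm 'I_n}) :
      perm_eq [seq rho s | s <- enum 'I_n] (enum 'I_n).
    apply: uniq_perm; rewrite ?enum_uniq //.
      by rewrite (map_inj_uniq (@perm_inj _ rho)) enum_uniq.
    by move=> v; rewrite -(permKV rho v) (mem_map (@perm_inj _ rho)) !mem_enum.
  by rewrite (permPl (enum_perm pi')) perm_sym enum_perm.
- rewrite sorted_map; apply: (@sub_sorted _ (relpre val leq)).
    by move=> s t; exact: p_sorted.
  by rewrite -sorted_map val_enum_ord iota_sorted.
Qed.
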